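(* Let $(e_n)$ be a basis of a Banach space $X$. Then the following assertions are equivalent: (a) $(e_n)$ is reverse partially greedy. (b) $(e_n)$ is quasi-greedy and reverse conservative.
   Context: Standing setting: $X$ is a real Banach space, possibly finite-dimensional, and $(e_n)$ is a seminormalized Schauder basis of $X$ (i.e. $0<\inf_n\|e_n\|\le\sup_n\|e_n\|<\infty$), with biorthogonal functionals $(e_n^* )$. If $\dim X=N<\infty$, $(e_n)_{n=1}^N$ is an algebraic basis, all indices and index sets lie in $\{1,\dots,N\}$ instead of $\mathbb{N}$, and $m\le N$. $\mathrm{supp}(x)=\{n: e_n^*(x)\ne0\}$; for an index set $A$, $P_A(x)=\sum_{i\in A}e_i^*(x)e_i$, $1_A=\sum_{i\in A}e_i$, $|A|$ is its cardinality; $A<B$ means $\max A<\min B$, and for an integer $b$, $A>b$ means every element of $A$ is $>b$ (vacuous if $A=\emptyset$). Greedy approximation: a greedy ordering for $x\in X$ is an injective map $\rho$ from the index set into itself with $\mathrm{supp}(x)$ contained in the range of $\rho$ and $|e_{\rho(j)}^*(x)|\ge|e_{\rho(k)}^*(x)|$ whenever $j<k$. Put $\Lambda_m(x)=\{\rho(1),\dots,\rho(m)\}$, $G_m(x)=\sum_{n\in\Lambda_m(x)}e_n^*(x)e_n$, $\beta_m(x)=\max\Lambda_m(x)$. Statements involving $G_m(x)$, $\Lambda_m(x)$, $\beta_m(x)$ are meant for any greedy ordering of $x$ (the same ordering throughout the statement). Definitions: $(e_n)$ is reverse partially greedy if there is $C$ such that $\|x-G_m(x)\|\le C\,\tilde\sigma_m^R(x)$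 for all $x\in X$, $m\in\mathbb{N}$, where $\tilde\sigma_m^R(x)=\inf\{\|x-P_A(x)\| : |A|\le m,\ A>\beta_m(x)\}$. It is quasi-greedy if there is $C$ with $\|G_m(x)\|\le C\|x\|$ for all $x\in X$, $m\in\mathbb{N}$. It is reverse conservative if there is $\Gamma_r$ with $\|1_A\|\le\Gamma_r\|1_B\|$ for all finite index sets $A,B$ with $B<A$ and $|A|\le|B|$. *)

(* Defs.v *)
From HB Require Import structures.
From mathcomp Require Import all_boot all_order all_algebra finmap.
From mathcomp Require Import all_classical all_reals all_analysis.

Set Implicit Arguments.
Unset Strict Implicit.
Unset Printing Implicit Defensive.

Import Order.TTheory GRing.Theory Num.Theory.
Import numFieldNormedType.Exports.

Local Open Scope classical_set_scope.
Local Open Scope ring_scope.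

(* The index set of the basis: {0, ..., N-1} if D = Some N (dimension N), and
   all of nat if D = None (infinite dimension).  Indices start at 0, and
   sequences indexed by nat are irrelevant outside of the index set. *)
Definition in_range (D : option nat) : pred nat :=
  fun n => if D is Some N then (n < N)%N else true.

Definition range_fset (D : option nat) (A : {fset nat}) : Prop :=
  forall i, i \in A -> in_range D i.

(* m ranges over the positive integers, with m <= N in dimension N. *)
Definition greedy_size (D : option nat) (m : nat) : Prop :=
  (0 < m)%N /\ (if D is Some N then (m <= N)%N else true).

Section bases.
Context {R : realType} {X : completeNormedModType R}.
Variables (D : option nat) (e : nat -> X).

Definition basis_expansion (a : nat -> R) (x : X) : Prop :=
  match D with
  | Some N => x = \sum_(0 <= n < N) a n *: e n
  | None => series (fun n => a n *: e n) @ \oo --> x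
  end.

(* A Schauder basis if D = None, an algebraic basis if D = Some N. *)
Definition schauder_basis : Prop :=
  forall x : X, exists2 a : nat -> R,
    basis_expansion a x & forall b, basis_expansion b x -> {in in_range D, b =1 a}.

Definition seminormalized : Prop :=
  (0 < ereal_inf [set `|e n|%:E | n in [set n | in_range D n]])%E /\
  (ereal_sup [set `|e n|%:E | n in [set n | in_range D n]] < +oo)%E.

Definition biorthogonal (es : nat -> {linear X -> R^o}) : Prop :=
  {in in_range D, forall n, continuous (es n)} /\
  {in in_range D &, forall i j, es i (e j) = (i == j)%:R}.

Definition indicator_vec (A : {fset nat}) : X := \sum_(i <- A) e i.

Variable es : nat -> {linear X -> R^o}.

Definition basis_supp (x : X) : set nat := [set n | in_range D n /\ es n x != 0].

Definition basis_proj (A : {fset nat}) (x : X) : X := \sum_(i <- A) es i x *: e i.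

Definition greedy_ordering (x : X) (rho : nat -> nat) : Prop :=
  [/\ {in in_range D, forall j, in_range D (rho j)},
      {in in_range D &, injective rho},
      basis_supp x `<=` rho @` [set j | in_range D j] &
      {in in_range D &, forall j k, (j < k)%N ->
        `|es (rho k) x| <= `|es (rho j) x|}].

Definition greedy_set (rho : nat -> nat) (m : nat) : {fset nat} :=
  [fset rho j | j in iota 0 m]%fset.

Definition greedy_sum (rho : nat -> nat) (m : nat) (x : X) : X :=
  basis_proj (greedy_set rho m) x.

Definition greedy_max (rho : nat -> nat) (m : nat) : nat :=
  \max_(i <- greedy_set rho m) i.

Definition sigmaR (rho : nat -> nat) (m : nat) (x : X) : R :=
  inf [set `|x - basis_proj A x| | A in
    [set A : {fset nat} | [/\ range_fset D A, (#|` A| <= m)%N &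
       forall i, i \in A -> (greedy_max rho m < i)%N]]].

Definition reverse_partially_greedy : Prop :=
  exists C : R, forall (x : X) (rho : nat -> nat), greedy_ordering x rho ->
    forall m, greedy_size D m ->
      `|x - greedy_sum rho m x| <= C * sigmaR rho m x.

Definition quasi_greedy : Prop :=
  exists C : R, forall (x : X) (rho : nat -> nat), greedy_ordering x rho ->
    forall m, greedy_size D m -> `|greedy_sum rho m x| <= C * `|x|.

Definition reverse_conservative : Prop :=
  exists C : R, forall A B : {fset nat},
    range_fset D A -> range_fset D B ->
    (forall i j, i \in B -> j \in A -> (i < j)%N) ->
    (#|` A| <= #|` B|)%N ->
    `|indicator_vec A| <= C * `|indicator_vec B|.

End bases.

(* Main.v *)
(* (a) => (b): the competitor A = set0 gives quasi-greediness, and comparing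
   x = 1_B + 1_A, whose greedy sum may be taken to be 1_B, with x - P_A x = 1_B
   gives reverse conservativeness.
   (b) => (a): let L be the greedy set of x and A > L with |A| <= |L|.  Then L
   is also a greedy set of y = x - P_A x, so that
   x - G_m(x) = (y - G_m(y)) + P_A x.  The coefficients of x on A are at most
   t, the smallest modulus of a coefficient on L, hence P_A x is controlled by
   t times the norms of the 1_A' with A' included in A, which are controlled by
   t ||1_L||, and then by ||P_L x|| = ||G_m(y)|| using quasi-greediness. *)
Require Import Defs.
From HB Require Import structures.
From mathcomp Require Import all_boot all_order all_algebra finmap.
From mathcomp Require Import all_classical all_reals all_analysis.
From mathcomp Require Import zify ring lra.
Import Order.TTheory GRing.Theory Num.Theory.
Import numFieldNormedType.Exports.
Local Open Scope ring_scope.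

(** * Norms of finite sums with varying coefficients *)

Section NormedSums.
Context {R : realType} {X : normedModType R}.
Implicit Types (f : nat -> X) (c : nat -> R) (s : seq nat) (v : X) (M : R).

(* A point of a parallelotope is a convex combination of its vertices. *)
Lemma norm_cube_le c f M s v :
  (forall i, 0 <= c i <= 1) ->
  (forall s', subseq s' s -> `|v + \sum_(i <- s') f i| <= M) ->
  `|v + \sum_(i <- s) c i *: f i| <= M.
Proof.
move=> c01; elim: s v => [|i s IH] v vertM.
  by have := vertM [::] isT; rewrite !big_nil.
have /andP[c0 c1] := c01 i.
have v0 : `|v + \sum_(j <- s) c j *: f j| <= M.
  by apply: IH => s' ss'; apply: vertM; apply: subseq_trans ss' (subseq_cons _ _).
have v1 : `|(v + f i) + \sum_(j <- s) c j *: f j| <= M.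
  apply: IH => s' ss'; have := vertM (i :: s').
  by rewrite /= eqxx big_cons addrA; apply.
rewrite big_cons.
set S := \sum_(j <- s) _ in v0 v1 *.
(* Convexity in the coordinate [i]: its two extreme values 0 and 1 are covered by [v0] and [v1]. *)
have -> : v + (c i *: f i + S) = (1 - c i) *: (v + S) + c i *: (v + f i + S).
  by rewrite [v + f i + S]addrAC [c i *: (_ + _)]scalerDr [RHS]addrA -scalerDl subrK scale1r addrA addrAC.
apply: le_trans (ler_normD _ _) _; rewrite !normrZ.
rewrite (ger0_norm c0) (@ger0_norm _ (1 - c i)); last by lra.
have := ler_wpM2l c0 v1.
have h : 0 <= 1 - c i by lra.
have := ler_wpM2l h v0; lra.
Qed.

(* Summation by parts: the left-hand side is a combination of tail sums whose
   nonnegative weights are the increments of [c], starting from [b]. *)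
Lemma norm_abel_le c f M s b :
  path (fun x y : R => x <= y) b [seq c i | i <- s] ->
  all (fun i => c i <= 1) s -> b <= 1 -> 0 <= M ->
  (forall k, `|\sum_(i <- drop k s) f i| <= M) ->
  `|\sum_(i <- s) (c i - b) *: f i| <= (1 - b) * M.
Proof.
elim: s b => [|i s IH] b /=.
  by move=> _ _ b1 M0 _; rewrite big_nil normr0 mulr_ge0 // subr_ge0.
move=> /andP[bci cs] /andP[ci1 s1] b1 M0 tailM.
(* The increment [c i - b] multiplies the whole tail; what remains is a sum of the same form with
   base [c i] instead of [b]. *)
have -> : \sum_(j <- i :: s) (c j - b) *: f j =
    (c i - b) *: \sum_(j <- i :: s) f j + \sum_(j <- s) (c j - c i) *: f j.
  rewrite !big_cons scalerDr -addrA; congr (_ + _).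
  rewrite scaler_sumr -big_split /=; apply: eq_bigr => j _.
  by rewrite -scalerDl; congr (_ *: _); ring.
apply: le_trans (ler_normD _ _) _.
have tl : `|\sum_(j <- s) (c j - c i) *: f j| <= (1 - c i) * M.
  by apply: IH => // k; apply: (tailM k.+1).
have hd := tailM 0%N; rewrite drop0 in hd.
have cb : 0 <= c i - b by rewrite subr_ge0.
rewrite normrZ (ger0_norm cb).
have := ler_wpM2l cb hd; lra.
Qed.

(** The positive and negative parts of the [a i / t] have values in [0, 1], so each part gives a
    point of the cube spanned by the subsums; the two parts account for the factor 2. *)
Lemma norm_bounded_coef_le f s (a : nat -> R) t M :
  0 <= t -> (forall i, i \in s -> `|a i| <= t) ->
  (forall s', subseq s' s -> `|\sum_(i <- s') f i| <= M) ->
  `|\sum_(i <- s) a i *: f i| <= 2 * (t * M).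
Proof.
move=> t0 at_ subM.
have M0 : 0 <= M by apply: le_trans (normr_ge0 _) (subM [::] (sub0seq _)).
have [t_eq0|tn0] := eqVneq t 0.
  rewrite big1_seq ?normr0 ?t_eq0 ?mul0r ?mulr0 // => i /andP[_ /at_].
  by rewrite t_eq0 normr_le0 => /eqP ->; rewrite scale0r.
have tp : 0 < t by rewrite lt_def tn0.
(* Truncating at 1 as well keeps the value in [0, 1] for every index, also outside [s], as
   [norm_cube_le] demands. *)
pose clip (x : R) := Num.min (Num.max (x / t) 0) 1.
have clip01 x : 0 <= clip x <= 1.
  by rewrite /clip le_min ge_min ler01 le_max lexx lexx !orbT.
have part (b : nat -> R) : `|\sum_(i <- s) clip (b i) *: f i| <= M.
  rewrite -[X in `|X|]add0r; apply: norm_cube_le => [i|s' /subM]; first exact: clip01.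
  by rewrite add0r.
have -> : \sum_(i <- s) a i *: f i =
    t *: (\sum_(i <- s) clip (a i) *: f i - \sum_(i <- s) clip (- a i) *: f i).
  rewrite -sumrB scaler_sumr; apply: eq_big_seq => i /at_; rewrite ler_norml => /andP[la ua].
  rewrite -scalerBl scalerA; congr (_ *: _).
  have l1 : -1 <= a i / t by rewrite ler_pdivlMr // mulN1r.
  have u1 : a i / t <= 1 by rewrite ler_pdivrMr // mul1r.
  have ta : t * (a i / t) = a i by rewrite mulrC divfK.
  rewrite /clip mulNr; set q := a i / t in l1 u1 ta *.
  rewrite -[LHS]ta; congr (_ * _).
  have [q0|] := boolP (0 <= q).
    rewrite (max_l q0) (min_l u1) max_r; last by lra.
    by rewrite (min_l ler01) subr0.
  rewrite -ltNge => q0.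
  rewrite (max_r (ltW q0)) (min_l ler01) max_l; last by lra.
  by rewrite min_l; lra.
rewrite normrZ gtr0_norm // mulrCA ler_pM2l //.
apply: le_trans (ler_normB _ _) _.
by have := part a; have := part (fun i => - a i); lra.
Qed.

End NormedSums.

(** * Construction and modification of greedy orderings *)

Section Orderings.
Context {R : realType} {X : completeNormedModType R}.
Variables (D : option nat) (e : nat -> X) (es : nat -> {linear X -> R^o}).
Hypothesis es_biorth : {in in_range D &, forall i j, es i (e j) = (i == j)%:R}.

Lemma in_range_leq j m : in_range D m -> (j <= m)%N -> in_range D j.
Proof. by case: D => //= N mN jm; apply: leq_ltn_trans mN. Qed.

Lemma in_range_greedy_size j m : greedy_size D m -> (j < m)%N -> in_range D j.
Proof. by case: D => [N [_ mN] jm|//]; apply: leq_trans mN. Qed.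

Lemma coef_sum (a : nat -> R) (s : seq nat) n :
  uniq s -> all (in_range D) s -> in_range D n ->
  es n (\sum_(i <- s) a i *: e i) = if n \in s then a n else 0.
Proof.
move=> us /allP sD nD; rewrite linear_sum /=.
have E i : i \in s -> es n (a i *: e i) = if i == n then a i else 0.
  move=> /sD iD; rewrite linearZ /= es_biorth //.
  by rewrite eq_sym; case: ifP => _; rewrite /GRing.scale /= ?mulr1 ?mulr0.
rewrite (eq_big_seq _ E) -big_mkcond /=.
case: ifPn => ns.
  by rewrite -big_filter filter_pred1_uniq // big_seq1.
by rewrite big1_seq // => i /andP[/eqP ->]; rewrite (negbTE ns).
Qed.

Lemma greedy_set_perm (rho : nat -> nat) m :
  {in in_range D &, injective rho} -> (forall j, (j < m)%N -> in_range D j) ->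
  perm_eq (greedy_set rho m) [seq rho j | j <- iota 0 m].
Proof.
move=> rinj mD; apply: uniq_perm; first exact: fset_uniq.
  rewrite map_inj_in_uniq ?iota_uniq // => i j; rewrite !mem_iota /= !add0n => im jm.
  by apply: rinj; apply: mD.
move=> i; apply/idP/idP.
  by move=> /imfsetP[j /= jm ->]; apply: map_f.
by move=> /mapP[j jm ->]; apply/imfsetP; exists j.
Qed.

(* The listing [s] is completed by the remaining indices below a bound [M] and
   then by the identity, which is [nth] with a varying default value. *)
Lemma greedy_ordering_seq (a : nat -> R) (s : seq nat) :
  uniq s -> all (in_range D) s -> pairwise (fun i j => `|a j| <= `|a i|) s ->
  exists rho, greedy_ordering D es (\sum_(i <- s) a i *: e i) rho /\
    forall k, (k <= size s)%N -> [seq rho j | j <- iota 0 k] = take k s.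
Proof.
move=> us sD sa.
(* In finite dimension [M] must be the dimension itself or at most that, so that [rho] stays within
   the index set. *)
pose M := if D is Some N then N else (\max_(i <- s) i).+1.
have sM i : i \in s -> (i < M)%N.
  rewrite /M; case: D sD => [N /allP sD|_] si; first exact: sD.
  by rewrite ltnS; exact: (@leq_bigmax_seq _ s xpredT id).
have DM i : (i < M)%N -> in_range D i by rewrite /M; case: D.
pose t := s ++ [seq i <- iota 0 M | i \notin s].
have tM : perm_eq t (iota 0 M).
  apply: uniq_perm; rewrite ?iota_uniq // /t.
    rewrite cat_uniq us filter_uniq ?iota_uniq // andbT /=.
    by apply/hasPn => i; rewrite mem_filter => /andP[].
  move=> i; rewrite mem_cat mem_filter mem_iota /= add0n.
  by case: (boolP (i \in s)) => //= /sM ->.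
have st : size t = M by rewrite (perm_size tM) size_iota.
have ut : uniq t by rewrite (perm_uniq tM) iota_uniq.
have mt i : (i \in t) = (i < M)%N by rewrite (perm_mem tM) mem_iota.
pose rho j := nth j t j.
have rlt j : (rho j < M)%N = (j < M)%N.
  rewrite /rho; case: (ltnP j M) => jM; first by rewrite -mt mem_nth ?st.
  by rewrite nth_default ?st // ltnNge jM.
have rge j : (M <= j)%N -> rho j = j by move=> jM; rewrite /rho nth_default ?st.
have rs j : (j < size s)%N -> rho j = nth 0%N s j.
  move=> js; rewrite /rho /t nth_cat js; exact: set_nth_default.
have sMsz : (size s <= M)%N by rewrite -st size_cat leq_addr.
exists rho; split; last first.
  move=> k ks; apply: (@eq_from_nth _ 0%N); first by rewrite size_map size_iota size_takel.
  move=> i; rewrite size_map size_iota => ik.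
  rewrite (nth_map 0%N) ?size_iota // nth_iota // add0n nth_take // rs //.
  exact: leq_trans ks.
have rD j : in_range D j -> in_range D (rho j).
  move=> jD; case: (ltnP j M) => jM; first by apply: DM; rewrite rlt.
  by rewrite rge.
split.
- by move=> j; apply: rD.
- move=> i j _ _ rij.
  case: (ltnP i M) => iM; last first.
    have jM : (M <= j)%N by rewrite leqNgt -rlt -rij rlt -leqNgt.
    by rewrite -(rge i iM) rij rge.
  have jM : (j < M)%N by rewrite -rlt -rij rlt.
  apply/eqP; rewrite -(nth_uniq i _ _ ut) ?st //; apply/eqP.
  by rewrite [RHS](set_nth_default j) ?st.
- move=> n /= [nD]; rewrite coef_sum //; case: ifP => [ns _|_]; last by rewrite eqxx.
  exists (index n s); first by apply/DM; apply: leq_trans sMsz; rewrite index_mem.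
  by rewrite rs ?index_mem // nth_index.
- move=> j k jD kD jk; rewrite !coef_sum ?rD //.
  case: (ltnP k (size s)) => ks; last first.
    (* Past the listing the coefficients vanish: the elements of [s] already occupy the first
       [size s] positions, and [rho] repeats no value. *)
    suff /negbTE -> : rho k \notin s by rewrite normr0.
    apply/negP => rks; have := rks; rewrite -index_mem => isz.
    have kM : (k < M)%N by rewrite -rlt sM.
    have : rho k = rho (index (rho k) s) by rewrite [RHS]rs // nth_index.
    have iM := leq_trans isz sMsz.
    rewrite {1 2}/rho (set_nth_default k (index _ _)) ?st // => /eqP.
    rewrite nth_uniq ?st // => /eqP ki.
    by move: isz; rewrite -ki ltnNge ks.
  have js := ltn_trans jk ks.
  rewrite !rs // !mem_nth //.
  by move/(pairwiseP 0%N): sa; apply.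
Qed.

(* Deleting [rho p] from the ordering shifts the later terms down; in finite
   dimension the deleted index is moved to the last place. *)
Lemma greedy_ordering_remove (x : X) rho m i :
  greedy_ordering D es x rho -> (forall j, (j < m)%N -> in_range D j) ->
  in_range D i -> (forall j, (j < m)%N -> rho j != i) ->
  exists rho', greedy_ordering D es (x - es i x *: e i) rho' /\
    forall j, (j < m)%N -> rho' j = rho j.
Proof.
move=> [rD rinj rsupp rdec] mD iD mi.
have cf n : in_range D n -> es n (x - es i x *: e i) = if n == i then 0 else es n x.
  move=> nD; rewrite linearB linearZ /= es_biorth // /GRing.scale /=.
  by case: eqP => [->|_]; rewrite ?mulr1 ?mulr0 ?subrr ?subr0.
(* An index that [rho] misses lies outside the support, so the vector does not change. *)
case: (pselect (exists2 p, in_range D p & rho p = i)) => [[p pD rpi]|noti]; last first.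
  have ix : es i x = 0.
    apply/eqP; apply: contra_notT noti => ix.
    have [|p pD rp] := rsupp i; first by split.
    by exists p.
  by exists rho; split=> //; rewrite ix scale0r subr0.
pose nx j := if (j < p)%N then j else if in_range D j.+1 then j.+1 else p.
have mp : (m <= p)%N.
  by rewrite leqNgt; apply/negP => /mi; rewrite rpi eqxx.
have nxD j : in_range D j -> in_range D (nx j).
  by rewrite /nx => jD; case: ifP => // _; case: ifP.
have Dle j k : in_range D k -> (j <= k)%N -> in_range D j by exact: in_range_leq.
(* Order is preserved except where the later position is sent to [p]; there the new coefficient is
   0, so monotonicity holds anyway. *)
have nxlt j k : in_range D k -> (j < k)%N -> nx k = p \/ (nx j < nx k)%N /\ nx j <> p.
  move=> kD jk; rewrite /nx; case: (ltnP k p) => kp.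
    by right; rewrite (ltn_trans jk kp); split=> //; lia.
  case: ifP => kD'; last by left.
  right; case: (ltnP j p) => jp; first by lia.
  by rewrite (Dle _ _ kD jk); lia.
have nxinj j k : in_range D k -> (j < k)%N -> nx j <> nx k.
  move=> kD jk; case: (nxlt _ _ kD jk) => [nk|]; last by lia.
  rewrite nk /nx; case: ifP => jp; first by lia.
  by rewrite (Dle _ _ kD jk); lia.
exists (rho \o nx); split; last first.
  by move=> j jm; rewrite /= /nx (leq_trans jm mp).
split.
- by move=> j jD /=; apply: rD; apply: nxD.
- move=> j k jD kD /= /rinj -/(_ (nxD _ jD) (nxD _ kD)) njk.
  case: (ltngtP j k) => // jk; first by case: (nxinj _ _ kD jk).
  by case: (nxinj _ _ jD jk).
- move=> n [nD]; rewrite cf //; case: (n =P i) => [_|ni nx0]; first by rewrite eqxx.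
  have [|k /= kD rk] := rsupp n; first by split.
  have kp : k <> p by move=> kp; apply: ni; rewrite -rk kp.
  case: (ltnP k p) => kp'; first by exists k => //=; rewrite /nx kp'.
  case: k => [|k] in kD rk kp kp' *; first by lia.
  exists k; first by apply: Dle kD _; lia.
  rewrite /= /nx kD ifF //; lia.
- move=> j k jD kD jk /=; rewrite !cf; try by apply: rD; apply: nxD.
  case: (nxlt _ _ kD jk) => [->|[lt_nx njp]]; first by rewrite rpi eqxx normr0.
  have -> : (rho (nx j) == i) = false.
    by apply/eqP; rewrite -rpi => /rinj; move/(_ (nxD _ jD) pD).
  case: ifP => _; first by rewrite normr0.
  by apply: rdec => //; apply: nxD.
Qed.

(** Indices are removed one at a time; the first [m] terms never change, so they keep avoiding the
    rest of [A]. *)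
Lemma greedy_ordering_removes (A : seq nat) (x : X) rho m :
  greedy_ordering D es x rho -> (forall j, (j < m)%N -> in_range D j) ->
  uniq A -> all (in_range D) A ->
  (forall i j, i \in A -> (j < m)%N -> rho j != i) ->
  exists rho', greedy_ordering D es (x - \sum_(i <- A) es i x *: e i) rho' /\
    forall j, (j < m)%N -> rho' j = rho j.
Proof.
move=> gx mD; elim: A => [|a A IH] /=.
  by move=> _ _ _; rewrite big_nil subr0; exists rho.
move=> /andP[aA uA] /andP[aD AD] disj.
have [i j iA|rho1 [g1 r1]] := IH uA AD.
  by apply: disj; rewrite inE iA orbT.
have [j jm|rho2 [g2 r2]] := greedy_ordering_remove _ _ _ _ g1 mD aD.
  by rewrite r1 //; apply: disj; rewrite ?mem_head.
exists rho2; split; last by move=> j jm; rewrite r2 // r1.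
(* The earlier removals left the coefficient at [a] equal to that of [x]. *)
move: g2; rewrite linearB /= coef_sum // (negbTE aA) subr0.
by rewrite -addrA -opprD big_cons [X in _ - X]addrC.
Qed.


Lemma greedy_size_seq (s : seq nat) k :
  uniq s -> all (in_range D) s -> (0 < k <= size s)%N -> greedy_size D k.
Proof.
move=> us /allP sD /andP[k0 ks]; split=> //; case: D sD => // N sN.
apply: leq_trans ks _; rewrite -[N](size_iota 0); apply: uniq_leq_size => // i /sN.
by rewrite mem_iota.
Qed.

Lemma greedy_sum_seq (a : nat -> R) (s : seq nat) rho k :
  uniq s -> all (in_range D) s -> greedy_size D k ->
  greedy_ordering D es (\sum_(i <- s) a i *: e i) rho ->
  [seq rho j | j <- iota 0 k] = take k s ->
  greedy_sum e es rho k (\sum_(i <- s) a i *: e i) = \sum_(i <- take k s) a i *: e i.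
Proof.
move=> us sD kD [_ rinj _ _] rs; rewrite /greedy_sum /basis_proj.
rewrite (perm_big _ (greedy_set_perm _ _ rinj _)) => [|j]; last exact: in_range_greedy_size.
rewrite /= rs; apply: eq_big_seq => i /mem_take si.
by rewrite coef_sum // ?si //; apply: (allP sD).
Qed.

(** * Estimates under quasi-greediness *)

Section QuasiGreedy.
Variable C : R.
Hypothesis C_ge1 : 1 <= C.
Hypothesis qg : forall (x : X) rho, greedy_ordering D es x rho ->
  forall m, greedy_size D m -> `|greedy_sum e es rho m x| <= C * `|x|.

(** Initial segments of a listing by decreasing modulus are greedy sums. The values of [k] that need
    not be greedy sizes are treated directly: 0, and those beyond the length, where $C \ge 1$
    suffices. *)
Lemma norm_take_le (a : nat -> R) (s : seq nat) k :
  uniq s -> all (in_range D) s -> pairwise (fun i j => `|a j| <= `|a i|) s ->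
  `|\sum_(i <- take k s) a i *: e i| <= C * `|\sum_(i <- s) a i *: e i|.
Proof.
move=> us sD sa; have [ks|sk] := leqP k (size s); last first.
  by rewrite take_oversize ?(ltnW sk) // ler_peMl.
case: k ks => [_|k ks].
  by rewrite take0 big_nil normr0 mulr_ge0 // (le_trans ler01).
have [rho [grho rs]] := greedy_ordering_seq _ _ us sD sa.
have kD : greedy_size D k.+1 by apply: (greedy_size_seq s).
by rewrite -(greedy_sum_seq _ _ _ _ us sD kD grho (rs _ ks)); apply: qg.
Qed.

(** With equal moduli every order of listing is greedy, so the indices satisfying [P] can be put
    first. *)
Lemma norm_filter_unit_coef_le (a : nat -> R) (P : pred nat) (s : seq nat) :
  uniq s -> all (in_range D) s -> (forall i, i \in s -> `|a i| = 1) ->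
  `|\sum_(i <- s | P i) a i *: e i| <= C * `|\sum_(i <- s) a i *: e i|.
Proof.
move=> us sD a1.
pose s1 := [seq i <- s | P i]; pose s2 := [seq i <- s | predC P i].
pose s' := s1 ++ s2.
have ss' : perm_eq s' s by rewrite perm_filterC.
rewrite -big_filter -/s1 -(perm_big _ ss') /=.
rewrite -[s1](@take_size_cat _ _ s1 s2 erefl) -/s'.
apply: norm_take_le; rewrite ?(perm_uniq ss') ?(perm_all _ ss') //.
apply/(pairwiseP 0%N) => i j ils jls _.
by rewrite !a1 // -(perm_mem ss') mem_nth.
Qed.

(* Summation by parts replaces the coefficients by t times their signs;
   quasi-greediness is then applied to the positive and negative parts. *)
Lemma norm_indicator_le (a : nat -> R) (s : seq nat) t :
  uniq s -> all (in_range D) s -> pairwise (fun i j => `|a j| <= `|a i|) s ->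
  0 <= t -> (forall i, i \in s -> t <= `|a i|) ->
  t * `|\sum_(i <- s) e i| <= 2 * C * (1 + C) * `|\sum_(i <- s) a i *: e i|.
Proof.
move=> us sD sa t0 ta.
have C0 : 0 <= C by apply: le_trans C_ge1.
have [->|tn0] := eqVneq t 0.
  by rewrite mul0r !mulr_ge0 // addr_ge0.
have tp : 0 < t by rewrite lt_def tn0.
have ap i : i \in s -> 0 < `|a i| by move=> /ta; apply: lt_le_trans.
set z := \sum_(i <- s) a i *: e i.
pose sg i : R := Num.sg (a i).
have sg1 i : i \in s -> `|sg i| = 1.
  by move=> /ap; rewrite normr_gt0 /sg normr_sg => ->.
have sgz : t * `|\sum_(i <- s) sg i *: e i| <= (1 + C) * `|z|.
  (* These weights turn [a i] into [t] times its sign; they increase along [s] because the moduli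
     decrease, and are at most 1 because [t] is a lower bound. *)
  pose c i := t / `|a i|.
  have -> : t * `|\sum_(i <- s) sg i *: e i| =
      `|\sum_(i <- s) (c i - 0) *: (a i *: e i)|.
    rewrite -[t in LHS](gtr0_norm tp) -normrZ scaler_sumr; congr `|_|.
    apply: eq_big_seq => i /ap ai; rewrite subr0 !scalerA /c; congr (_ *: _).
    by rewrite [X in _ / _ * X](numEsg (a i)) -/(sg i) mulrCA divfK ?gt_eqF // mulrC.
  have -> : (1 + C) * `|z| = (1 - 0) * ((1 + C) * `|z|) by rewrite subr0 mul1r.
  apply: norm_abel_le => //.
  - suff : pairwise (fun x y : R => x <= y) (0 :: [seq c i | i <- s]) by move/pairwise_sorted.
    rewrite /= all_map pairwise_map; apply/andP; split.
      by apply/allP => i /ap ai /=; rewrite divr_ge0.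
    apply: (@sub_in_pairwise _ (mem s)) sa; last by apply/allP.
    move=> i j /ap ai /ap aj /= aij.
    by rewrite /c ler_pM2l // lef_pV2.
  - by apply/allP => i si; rewrite /c ler_pdivrMr ?ap // mul1r ta.
  - by rewrite mulr_ge0 // addr_ge0.
  (* A tail is [z] minus an initial segment, which costs the factor $1 + C$. *)
  - move=> k; rewrite mulrDl mul1r.
    have -> : \sum_(i <- drop k s) a i *: e i = z - \sum_(i <- take k s) a i *: e i.
      by rewrite /z -{2}(cat_take_drop k s) big_cat /= addrC addrK.
    by apply: le_trans (ler_normB _ _) _; rewrite lerD2l norm_take_le.
have split_s : `|\sum_(i <- s) e i| <= 2 * C * `|\sum_(i <- s) sg i *: e i|.
  have parts (P : pred nat) : `|\sum_(i <- s | P i) sg i *: e i| <= _ :=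
    norm_filter_unit_coef_le _ P _ us sD sg1.
  rewrite (bigID (fun i => 0 < a i)) /=; apply: le_trans (ler_normD _ _) _.
  have -> : \sum_(i <- s | 0 < a i) e i = \sum_(i <- s | 0 < a i) sg i *: e i.
    by apply: eq_bigr => i ai; rewrite /sg gtr0_sg // scale1r.
  have -> : \sum_(i <- s | ~~ (0 < a i)) e i = - \sum_(i <- s | ~~ (0 < a i)) sg i *: e i.
    rewrite -sumrN big_seq_cond [RHS]big_seq_cond; apply: eq_bigr => i /andP[/ap].
    rewrite normr_gt0 -leNgt => ai0 ai; rewrite /sg ltr0_sg ?scaleN1r ?opprK //.
    by rewrite lt_neqAle ai0.
  rewrite normrN.
  have := parts (fun i => 0 < a i); have := parts (fun i => ~~ (0 < a i)); lra.
have := ler_wpM2l t0 split_s.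
have : 2 * C * (t * `|\sum_(i <- s) sg i *: e i|) <= 2 * C * ((1 + C) * `|z|).
  by apply: ler_wpM2l => //; rewrite mulr_ge0.
lra.
Qed.

(** In the constant, $1 + C$ bounds $y - G_m(y)$. The other term bounds $P_A x$: 2 for the signs of
    its coefficients, [Gam] for passing from subsets of [A] to the greedy set, $2C(1+C)$ for passing
    from the indicator to $G_m(y)$, and the last $C$ for passing from $G_m(y)$ to $y$. *)
Lemma norm_sub_greedy_sum_le Gam (x : X) rho m (A : {fset nat}) :
  0 <= Gam ->
  (forall A' B' : {fset nat}, range_fset D A' -> range_fset D B' ->
    (forall i j, i \in B' -> j \in A' -> (i < j)%N) ->
    (#|` A'| <= #|` B'|)%N ->
    `|indicator_vec e A'| <= Gam * `|indicator_vec e B'|) ->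
  greedy_ordering D es x rho -> greedy_size D m ->
  range_fset D A -> (#|` A| <= m)%N ->
  (forall i, i \in A -> (greedy_max rho m < i)%N) ->
  `|x - greedy_sum e es rho m x| <=
    (1 + C + 2 * Gam * (2 * C * (1 + C)) * C) * `|x - basis_proj e es A x|.
Proof.
move=> Gam0 rc grho mN AD Am Amax; have [rD rinj rsupp rdec] := grho.
have mD j : (j < m)%N -> in_range D j by exact: in_range_greedy_size.
have C0 : 0 <= C by apply: le_trans C_ge1.
have m0 : (0 < m)%N by case: mN.
pose s := [seq rho j | j <- iota 0 m].
have Lam : perm_eq (greedy_set rho m) s by apply: greedy_set_perm.
have us : uniq s by rewrite -(perm_uniq Lam) fset_uniq.
have sP i : i \in s -> exists2 j, (j < m)%N & i = rho j.
  by move=> /mapP[j]; rewrite mem_iota add0n => jm ->; exists j.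
have sD : all (in_range D) s by apply/allP => i /sP[j jm ->]; apply/rD/mD.
have sa : pairwise (fun i j => `|es j x| <= `|es i x|) s.
  apply/(pairwiseP 0%N) => i j; rewrite !inE size_map size_iota => im jm ij.
  rewrite !(nth_map 0%N) ?size_iota // !nth_iota // !add0n.
  by apply: rdec => //; apply: mD.
have sA i j : i \in A -> j \in s -> (j < i)%N.
  move=> iA js; apply: leq_ltn_trans (Amax _ iA).
  by apply: (@leq_bigmax_seq _ _ xpredT id) => //; rewrite (perm_mem Lam).
have disj i j : i \in (A : seq nat) -> (j < m)%N -> rho j != i.
  move=> iA jm; rewrite neq_ltn sA // map_f // mem_iota; exact: jm.
have AD' : all (in_range D) A by apply/allP => i; apply: AD.
have [rho' [grho' rr]] := greedy_ordering_removes A _ _ _ grho mD (fset_uniq A) AD' disj.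
set y := x - basis_proj e es A x.
pose z := \sum_(i <- s) es i x *: e i.
have Gx : greedy_sum e es rho m x = z by rewrite /greedy_sum /basis_proj (perm_big _ Lam).
have Gy : greedy_sum e es rho' m y = z.
  have [_ rinj' _ _] := grho'.
  rewrite /greedy_sum /basis_proj (perm_big _ (greedy_set_perm _ _ rinj' mD)) /=.
  have -> : [seq rho' j | j <- iota 0 m] = s.
    by apply/eq_in_map => j; rewrite mem_iota => /rr.
  apply: eq_big_seq => i si; rewrite linearB /= coef_sum ?fset_uniq ?(allP sD) //.
  case: ifP => [iA|_]; last by rewrite subr0.
  by have := sA _ _ iA si; rewrite ltnn.
have zy : `|z| <= C * `|y| by rewrite -Gy; apply: qg.
(* Positions start at 0, so [m.-1] is the last greedy position and [t] the smallest modulus on the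
   greedy set. *)
pose t := `|es (rho m.-1) x|.
have mt : (m.-1 < m)%N by rewrite prednK.
have ts i : i \in s -> t <= `|es i x|.
  move=> /sP[j jm ->]; rewrite /t.
  have [->//|jm1] := eqVneq j m.-1.
  apply: rdec; [exact: mD|exact: mD|lia].
(* A nonzero coefficient on [A] is listed by [rho] at some position, which is at least [m] by
   disjointness. *)
have tA i : i \in (A : seq nat) -> `|es i x| <= t.
  move=> iA; have [->|ix] := eqVneq (es i x) 0; first by rewrite normr0 normr_ge0.
  have [|k kD rk] := rsupp i; first by split=> //; apply: AD.
  rewrite -rk; apply: rdec => //; first exact: mD.
  have : ~~ (k < m)%N by apply/negP => km; have := disj _ _ iA km; rewrite rk eqxx.
  lia.
(* Every sublist of [A] is again to the right of the greedy set and no larger than it, so reverse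
   conservativeness applies to all of them. *)
have PA : `|basis_proj e es A x| <= 2 * (t * (Gam * `|\sum_(i <- s) e i|)).
  apply: norm_bounded_coef_le => [||s' s'A]; [exact: normr_ge0 | exact: tA |].
  have us' : uniq s' by apply: subseq_uniq s'A (fset_uniq A).
  have ps' : perm_eq [fset i in s']%fset s'.
    by apply: uniq_perm => // i; rewrite !inE.
  rewrite -(perm_big _ ps') -(perm_big _ Lam); apply: rc.
  - by move=> i; rewrite !inE => /(mem_subseq s'A); apply: AD.
  - by move=> i; rewrite (perm_mem Lam); apply: (allP sD).
  - by move=> i j; rewrite (perm_mem Lam) !inE => si /(mem_subseq s'A) /sA; apply.
  - rewrite (perm_size ps') (perm_size Lam) size_map size_iota.
    exact: leq_trans (size_subseq s'A) Am.
have tz := norm_indicator_le (fun i => es i x) s t us sD sa (normr_ge0 _) ts.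
have -> : x - greedy_sum e es rho m x = y - z + basis_proj e es A x.
  by rewrite Gx /y addrAC subrK.
apply: le_trans (ler_normD _ _) _.
have h1 : `|y - z| <= (1 + C) * `|y|.
  by rewrite mulrDl mul1r; apply: le_trans (ler_normB _ _) _; rewrite lerD2l.
have h2 : Gam * (t * `|\sum_(i <- s) e i|) <= Gam * (2 * C * (1 + C) * (C * `|y|)).
  apply: ler_wpM2l => //; apply: le_trans tz _; apply: ler_wpM2l => //.
  by rewrite !mulr_ge0 // addr_ge0.
lra.
Qed.

End QuasiGreedy.

(** * The infimum over competitors and the two implications *)

Definition reverse_competitor rho m (A : {fset nat}) : Prop :=
  [/\ range_fset D A, (#|` A| <= m)%N &
     forall i, i \in A -> (greedy_max rho m < i)%N].

Lemma reverse_competitor0 rho m : reverse_competitor rho m fset0.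
Proof. by split=> [i||i]; rewrite ?inE ?cardfs0. Qed.

Lemma sigmaR_le rho m (x : X) A : reverse_competitor rho m A ->
  sigmaR D e es rho m x <= `|x - basis_proj e es A x|.
Proof.
move=> cA; apply: ge_inf; first by exists 0 => _ [B _ <-].
by exists A.
Qed.

Lemma le_sigmaR rho m (x : X) r :
  (forall A, reverse_competitor rho m A -> r <= `|x - basis_proj e es A x|) ->
  r <= sigmaR D e es rho m x.
Proof.
move=> rle; apply: lb_le_inf => [|_ [A cA <-]]; last exact: rle.
by exists `|x - basis_proj e es fset0 x|, fset0 => //; apply: reverse_competitor0.
Qed.

Lemma reverse_partially_greedy_quasi_greedy :
  reverse_partially_greedy D e es -> quasi_greedy D e es.
Proof.
move=> [C rpg]; exists (1 + Num.max C 0) => x rho grho m mN.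
have := sigmaR_le rho m x fset0 (reverse_competitor0 _ _).
rewrite /basis_proj big_nil subr0 => sx.
have s0 : 0 <= sigmaR D e es rho m x by apply: le_sigmaR.
(* [C] may be negative, and $\tilde\sigma_m^R(x) \le \|x\|$ can be multiplied only by a nonnegative
   constant. *)
have CM : C <= Num.max C 0 by rewrite le_max lexx.
have M0 : 0 <= Num.max C 0 by rewrite le_max lexx orbT.
have h1 := rpg _ _ grho _ mN.
have h2 := ler_wpM2r s0 CM.
have h3 := ler_wpM2l M0 sx.
have := ler_normB x (x - greedy_sum e es rho m x); rewrite subKr.
lra.
Qed.

Lemma reverse_partially_greedy_reverse_conservative :
  reverse_partially_greedy D e es -> reverse_conservative D e.
Proof.
move=> [C rpg]; exists (Num.max C 0) => A B AD BD BA AB.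
(* An empty [B] is set apart because its size, to be used as [m], must be positive. *)
have [B0|Bpos] := posnP (#|` B|)%N.
  move: AB; rewrite B0 leqn0 cardfs_eq0 => /eqP ->.
  by rewrite /indicator_vec big_nil normr0 mulr_ge0 // le_max lexx orbT.
(* All coefficients will be 1, so ties may be broken in favour of [B], which becomes the greedy set
   of size [m]. *)
pose s := (B : seq nat) ++ (A : seq nat).
have us : uniq s.
  rewrite cat_uniq !fset_uniq /= andbT; apply/hasPn => i iA; apply/negP => iB.
  by have := BA _ _ iB iA; rewrite ltnn.
have sD : all (in_range D) s.
  by rewrite all_cat; apply/andP; split; apply/allP => i; [apply: BD | apply: AD].
pose one (_ : nat) : R := 1.
have sa : pairwise (fun i j => `|one j| <= `|one i|) s.
  by apply/(pairwiseP 0%N) => i j _ _ _.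
have [rho [grho rs]] := greedy_ordering_seq one _ us sD sa.
pose m := size B.
have ms : (m <= size s)%N by rewrite size_cat leq_addr.
have mN : greedy_size D m by apply: (greedy_size_seq s); rewrite // ms andbT.
have rB : [seq rho j | j <- iota 0 m] = B by rewrite rs // take_size_cat.
have onev (r : seq nat) : \sum_(i <- r) one i *: e i = \sum_(i <- r) e i.
  by apply: eq_bigr => i _; rewrite scale1r.
pose x := \sum_(i <- s) one i *: e i.
have Gx : greedy_sum e es rho m x = indicator_vec e B.
  by rewrite (greedy_sum_seq one s rho m us sD mN grho) ?rs // take_size_cat // onev.
have PA : basis_proj e es A x = indicator_vec e A.
  rewrite -[RHS]onev; apply: eq_big_seq => i iA.
  by rewrite coef_sum ?mem_cat ?iA ?orbT //; apply: AD.
have xE : x = indicator_vec e B + indicator_vec e A by rewrite /x onev big_cat.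
have cA : reverse_competitor rho m A.
  split=> // i iA; have [_ rinj _ _] := grho.
  have LB : perm_eq (greedy_set rho m) B.
    by rewrite -rB; apply: greedy_set_perm => // j; apply: in_range_greedy_size.
  (* An element of [B] shows that [i] is positive, so the strict bound on the maximum can be
     restated as a bound by [i.-1]. *)
  have [b bB] : exists b, b \in B by apply/fset0Pn; rewrite -cardfs_gt0.
  have i0 : (0 < i)%N by apply: leq_ltn_trans (BA _ _ bB iA).
  rewrite -(prednK i0) ltnS; apply/bigmax_leqP_seq => j.
  by rewrite (perm_mem LB) => jB _; rewrite -ltnS prednK //; apply: BA.
have := rpg x rho grho m mN; rewrite Gx {1}xE addrAC subrr add0r => h1.
have := sigmaR_le rho m x A cA; rewrite PA {2}xE addrK => sx.
have s0 : 0 <= sigmaR D e es rho m x by apply: le_sigmaR.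
have CM : C <= Num.max C 0 by rewrite le_max lexx.
have M0 : 0 <= Num.max C 0 by rewrite le_max lexx orbT.
have := ler_wpM2r s0 CM; have := ler_wpM2l M0 sx; lra.
Qed.

Lemma quasi_greedy_reverse_partially_greedy :
  quasi_greedy D e es -> reverse_conservative D e -> reverse_partially_greedy D e es.
Proof.
move=> [C0 qg0] [G0 rc0].
(* The constants are enlarged to meet $C \ge 1$ and $G \ge 0$; this makes [K] positive. *)
pose C := Num.max C0 1; pose G := Num.max G0 0.
have C1 : 1 <= C by rewrite le_max lexx orbT.
have Gge0 : 0 <= G by rewrite le_max lexx orbT.
have C00 : C0 <= C by rewrite le_max lexx.
have G00 : G0 <= G by rewrite le_max lexx.
pose K := 1 + C + 2 * G * (2 * C * (1 + C)) * C.
have K0 : 0 < K.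
  by rewrite /K ltr_wpDr ?ltr_wpDr // ?mulr_ge0 ?addr_ge0 //; lra.
exists K => x rho grho m mN.
(* After division by [K] the claim is that the left-hand side is a lower bound over all competitors,
   which is checked one [A] at a time. *)
rewrite mulrC -ler_pdivrMr //; apply: le_sigmaR => A [AD Am Amax].
rewrite ler_pdivrMr // mulrC; apply: norm_sub_greedy_sum_le => //.
  move=> x' rho' g' m' mN'; apply: le_trans (qg0 _ _ g' _ mN') _.
  exact: ler_wpM2r.
move=> A' B' A'D B'D BA' AB'; apply: le_trans (rc0 _ _ A'D B'D BA' AB') _.
exact: ler_wpM2r.
Qed.

End Orderings.

Theorem theorem2p7 (R : realType) (X : completeNormedModType R)
  (D : option nat) (e : nat -> X) (es : nat -> {linear X -> R^o})
  (e_basis : schauder_basis D e) (e_seminorm : seminormalized D e)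
  (es_biorth : biorthogonal D e es) :
  reverse_partially_greedy D e es <->
  quasi_greedy D e es /\ reverse_conservative D e.
Proof.
have [_ eb] := es_biorth; split=> [rpg|[qg rc]]; last first.
  exact: quasi_greedy_reverse_partially_greedy.
split; first exact: reverse_partially_greedy_quasi_greedy.
exact: reverse_partially_greedy_reverse_conservative rpg.
Qed.
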